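(* Let $M\in\mathring K_{>0}$ and let $C\subset\mathring K^n$ be an $M$-cell. Then $C$ satisfies the Whitney arc property.
   Context: Throughout, $K$ is an $\aleph_1$-saturated o-minimal structure expanding a field; ''definable'' means definable in $K$ with parameters; $|\cdot|$ is the Euclidean norm. $\mathring K$ is the set of finite elements of $K$ (those bounded in absolute value by a natural number), and $\operatorname{st}$ is the standard part map. $M$-functions and $M$-cells ($M\in K_{>0}$). A definable differentiable function $f$ is an $M$-function if $|Df|\le M$ on its domain (operator norm; on a $\mathcal C^1$ cell that is not open, $Df(x)$ is the differential on the tangent space of the cell). In $K^1$ an $M$-cell is a point or an interval $(a,b)$ with $a<b$ in $K$. An $M$-cell in $K^{m+1}$ is either the graph of a definable $\mathcal C^1$ $M$-function $f:X\to K$, or a set $\{(x,r)\in X\times K: f(x)<r<g(x)\}$ with $f<g$ definable $\mathcal C^1$ $M$-functions on $X$, where $X\subseteq K^m$ is an $M$-cell. Whitney arc property. A definable set $A\subset K^n$ satisfies the Whitney arc property if there is a constant $c\in\mathring K_{>0}$ such that for all $x,y\in A$ there is a definable curve (continuous definable map) $\gamma:[0,1]\to A$ with $\gamma(0)=x$, $\gamma(1)=y$ and $\operatorname{length}(\gamma):=\int_0^1|\gamma'|\le c|x-y|$. The integral is the one for the Berarducci-Otero measure $\mathcal L^1$: $\int_0^1|\gamma'|$ is the integral over $[0,1]\subset K$ of $\operatorname{st}(|\gamma'(t)|)$ with respect to $\mathcal L^1$, where $\mathcal L^1$ is the completed measure on the $\sigma$-ring generated by the definable subsets of $K$ of finite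 diameter, with $\mathcal L^1(S)$ equal to the Lebesgue measure of $\operatorname{st}(S)$ for definable $S\subset\mathring K$. It is a real number, and the inequality is understood with the right-hand side replaced by its standard part. *)

(* Defs.v *)
From HB Require Import structures.
From mathcomp Require Import all_boot all_order all_algebra.
From mathcomp Require Import all_classical all_reals all_analysis.

Set Implicit Arguments.
Unset Strict Implicit.
Unset Printing Implicit Defensive.

Import Order.TTheory GRing.Theory Num.Theory.
Import numFieldNormedType.Exports.

Local Open Scope classical_set_scope.
Local Open Scope ring_scope.

(* The symbols in addition to those of ordered rings. *)
Record signature := Signature {
  fsym : Type;
  farity : fsym -> nat;
  rsym : Type;
  rarity : rsym -> nat }.

Record expansion (L : signature) (K : Type) := Expansion {
  fint : forall f : fsym L, ('I_(farity f) -> K) -> K;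
  rint : forall r : rsym L, ('I_(rarity r) -> K) -> Prop }.

(* Terms and formulas of the language with a constant for each element of K;
   variables are named by natural numbers. *)
Inductive term (L : signature) (K : Type) : Type :=
| TVar of nat
| TPar of K
| TAdd of term L K & term L K
| TMul of term L K & term L K
| TFun (f : fsym L) of ('I_(farity f) -> term L K).

Inductive formula (L : signature) (K : Type) : Type :=
| FEq of term L K & term L K
| FLt of term L K & term L K
| FRel (r : rsym L) of ('I_(rarity r) -> term L K)
| FNot of formula L K
| FAnd of formula L K & formula L K
| FEx of nat & formula L K.

(* K is taken in rcfType to have square roots at hand: the ordered field
   underlying an o-minimal structure is real closed (Pillay-Steinhorn). *)
Section Semantics.
Context (L : signature) (K : rcfType) (S : expansion L K).

Fixpoint teval (e : nat -> K) (t : term L K) : K :=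
  match t with
  | TVar i => e i
  | TPar a => a
  | TAdd t1 t2 => teval e t1 + teval e t2
  | TMul t1 t2 => teval e t1 * teval e t2
  | TFun f ts => fint S (fun i => teval e (ts i))
  end.

Fixpoint sat (e : nat -> K) (p : formula L K) : Prop :=
  match p with
  | FEq t1 t2 => teval e t1 = teval e t2
  | FLt t1 t2 => teval e t1 < teval e t2
  | FRel r ts => rint S (fun i => teval e (ts i))
  | FNot q => ~ sat e q
  | FAnd q1 q2 => sat e q1 /\ sat e q2
  | FEx i q => exists a : K, sat (fun j => if j == i then a else e j) q
  end.

Fixpoint term_over (A : set K) (t : term L K) : Prop :=
  match t with
  | TVar _ => True
  | TPar a => A a
  | TAdd t1 t2 => term_over A t1 /\ term_over A t2
  | TMul t1 t2 => term_over A t1 /\ term_over A t2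
  | TFun f ts => forall i, term_over A (ts i)
  end.

Fixpoint formula_over (A : set K) (p : formula L K) : Prop :=
  match p with
  | FEq t1 t2 => term_over A t1 /\ term_over A t2
  | FLt t1 t2 => term_over A t1 /\ term_over A t2
  | FRel r ts => forall i, term_over A (ts i)
  | FNot q => formula_over A q
  | FAnd q1 q2 => formula_over A q1 /\ formula_over A q2
  | FEx _ q => formula_over A q
  end.

(* The variables 0, ..., n-1 stand for the coordinates of x; the others get the
   dummy value 0. *)
Definition point_env n (x : 'rV[K]_n) (i : nat) : K :=
  if insub i is Some j then x 0 j else 0.

Definition holds n (x : 'rV[K]_n) (p : formula L K) : Prop :=
  sat (point_env x) p.

Definition definable n (A : set 'rV[K]_n) : Prop :=
  exists p : formula L K, A = [set x | holds x p].

Definition definable1 (A : set K) : Prop :=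
  definable [set x : 'rV[K]_1 | A (x 0 0)].

Definition o_minimal : Prop :=
  forall A : set K, definable1 A ->
    exists s : seq (interval K), A = \bigcup_(I in [set` s]) [set` I].

Definition aleph1_saturated : Prop :=
  forall (A : set K) (n : nat) (Gamma : set (formula L K)),
    countable A ->
    (forall p, Gamma p -> formula_over A p) ->
    (forall (k : nat) (p : 'I_k -> formula L K), (forall i, Gamma (p i)) ->
       exists x : 'rV[K]_n, forall i, holds x (p i)) ->
    exists x : 'rV[K]_n, forall p, Gamma p -> holds x p.

End Semantics.

Definition finite_elt (K : rcfType) (x : K) : Prop :=
  exists k : nat, `|x| <= k%:R.

(* The real cut out in the rationals by x (a junk value if x is not finite). *)
Definition st (R : realType) (K : rcfType) (x : K) : R :=
  sup [set ratr q | q in [set q : rat | ratr q < x]].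

Definition enorm (K : rcfType) n (v : 'rV[K]_n) : K :=
  Num.sqrt (\sum_(i < n) v 0 i ^+ 2).

Section Cells.
Context (L : signature) (K : rcfType) (S : expansion L K).

Definition graph_over m (X : set 'rV[K]_m) (f : 'rV[K]_m -> K) :
    set 'rV[K]_m.+1 :=
  [set z | X (col' ord_max z) /\ z 0 ord_max = f (col' ord_max z)].

Definition band_over m (X : set 'rV[K]_m) (f g : 'rV[K]_m -> K) :
    set 'rV[K]_m.+1 :=
  [set z | X (col' ord_max z) /\
           f (col' ord_max z) < z 0 ord_max < g (col' ord_max z)].

(* f is considered as a function on X only; its values outside X are ignored. *)
Definition definable_fun m (X : set 'rV[K]_m) (f : 'rV[K]_m -> K) : Prop :=
  definable S (graph_over X f).

(* Velocities at x of curves in X; for a C^1 submanifold X (such as a cell),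
   this is the tangent space of X at x. *)
Definition tangent m (X : set 'rV[K]_m) (x : 'rV[K]_m) : set 'rV[K]_m :=
  [set v | exists c : K -> 'rV[K]_m,
     [/\ \forall s \near 0, X (c s), c 0 = x & is_derive (0 : K) 1 c v]].

(* a is a first-order expansion of f at x along X. When X is a C^1 submanifold,
   f is differentiable at x as a function on X iff there is such an a, and the
   differential is then the restriction to the tangent space of v |-> v *m a
   (only this restriction is determined by f). *)
Definition differential_on m (X : set 'rV[K]_m) (f : 'rV[K]_m -> K)
    (x : 'rV[K]_m) (a : 'cV[K]_m) : Prop :=
  forall e : K, 0 < e -> \forall y \near within X (nbhs x),
    `|f y - f x - ((y - x) *m a) 0 0| <= e * enorm (y - x).

(* On a C^1 submanifold X, f is C^1 iff its differentials can be represented by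
   a field A of covectors of K^m which is continuous on X: given a chart, take
   the differential of f in the chart composed with the coordinate projection. *)
Definition C1_Mfun (M : K) m (X : set 'rV[K]_m) (f : 'rV[K]_m -> K) : Prop :=
  definable_fun X f /\
  exists A : 'rV[K]_m -> 'cV[K]_m,
    [/\ {within X, continuous A},
        forall x, X x -> differential_on X f x (A x) &
        forall x, X x -> forall v, tangent X x v ->
          `|(v *m A x) 0 0| <= M * enorm v].

Inductive Mcell (M : K) : forall n, set 'rV[K]_n -> Prop :=
| Mcell_point (a : K) :
    Mcell M [set x : 'rV[K]_1 | x 0 0 = a]
| Mcell_interval (a b : K) :
    a < b -> Mcell M [set x : 'rV[K]_1 | a < x 0 0 < b]
| Mcell_graph m (X : set 'rV[K]_m) (f : 'rV[K]_m -> K) :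
    Mcell M X -> C1_Mfun M X f -> Mcell M (graph_over X f)
| Mcell_band m (X : set 'rV[K]_m) (f g : 'rV[K]_m -> K) :
    Mcell M X -> C1_Mfun M X f -> C1_Mfun M X g ->
    (forall x, X x -> f x < g x) -> Mcell M (band_over X f g).

End Cells.

Section BerarducciOtero.
Context (L : signature) (K : rcfType) (S : expansion L K).

Definition finite_diameter (A : set K) : Prop :=
  exists k : nat, forall x y, A x -> A y -> `|x - y| <= k%:R.

(* K with the semiring of sets of definable sets of finite diameter. *)
Definition BO_type (_ : expansion L K) : Type := K.

Definition BO_sets : set (set (BO_type S)) :=
  [set A : set K | definable1 S A /\ finite_diameter A].

Lemma BO_sets0 : BO_sets set0.
Proof.
split; last by exists 0%N.
exists (FLt (TVar _ _ 0) (TVar _ _ 0)).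
by apply/seteqP; split=> x //=; rewrite /holds /= ltxx.
Qed.

Lemma BO_setsI : setI_closed BO_sets.
Proof.
move=> A B [[p pA] [k kA]] [[q qB] _]; split; last first.
  by exists k => x y [Ax _] [Ay _]; exact: kA.
exists (FAnd p q); apply/seteqP; split=> x /=.
- move=> [Ax Bx]; rewrite /holds /=; split.
  + by have : [set x | holds S x p] x by rewrite -pA.
  + by have : [set x | holds S x q] x by rewrite -qB.
- move=> [px qx]; split.
  + by have : [set x : 'rV[K]_1 | A (x 0 0)] x by rewrite pA.
  + by have : [set x : 'rV[K]_1 | B (x 0 0)] x by rewrite qB.
Qed.

Lemma BO_setsD : semi_setD_closed BO_sets.
Proof.
apply: setD_semi_setD_closed => A B [[p pA] [k kA]] [[q qB] _]; split; last first.
  by exists k => x y [Ax _] [Ay _]; exact: kA.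
exists (FAnd p (FNot q)); apply/seteqP; split=> x /=.
- move=> [Ax Bx]; rewrite /holds /=; split.
  + by have : [set x | holds S x p] x by rewrite -pA.
  + move=> qx; apply: Bx.
    by have : [set x : 'rV[K]_1 | B (x 0 0)] x by rewrite qB.
- move=> [px qx]; split.
  + by have : [set x : 'rV[K]_1 | A (x 0 0)] x by rewrite pA.
  + move=> Bx; apply: qx.
    by have : [set x | holds S x q] x by rewrite -qB.
Qed.

Definition BO_display : expansion L K -> measure_display.
Proof. by move=> _; exact: default_measure_display. Qed.

HB.instance Definition _ := Pointed.on (BO_type S).
HB.instance Definition _ := @isSemiRingOfSets.Build (BO_display S) (BO_type S)
  BO_sets BO_sets0 BO_setsI BO_setsD.

Context (R : realType).

(* A set of finite diameter that is not contained in the finite part of K is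
   first translated by one of its elements. *)
Definition BO_base (A : set K) : K :=
  if `[< A `<=` @finite_elt K >] then 0 else xget 0 A.

Definition BO_premeasure (A : set (BO_type S)) : \bar R :=
  lebesgue_measure [set st R (x - BO_base A) | x in (A : set K)].

Lemma BO_premeasure0 : BO_premeasure set0 = 0%E.
Proof. by rewrite /BO_premeasure image_set0 measure0. Qed.

Lemma BO_premeasure_ge0 (A : set (BO_type S)) : (0 <= BO_premeasure A)%E.
Proof. exact: measure_ge0. Qed.

Definition BO_outer : set (BO_type S) -> \bar R := mu_ext BO_premeasure.

HB.instance Definition _ := isOuterMeasure.Build R (BO_type S) BO_outer
  (mu_ext0 BO_premeasure0 BO_premeasure_ge0)
  (mu_ext_ge0 BO_premeasure_ge0)
  (@le_mu_ext _ _ R BO_premeasure)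
  (mu_ext_sigma_subadditive BO_premeasure_ge0).

(* The premeasure is countably additive when the structure is o-minimal and
   aleph_1-saturated (Berarducci-Otero). By Caratheodory's theorem, on the
   subsets of a set of finite diameter the following measure is then the
   completion of its unique extension to the generated sigma-ring. *)
Definition L1 : set (caratheodory_type BO_outer) -> \bar R := BO_outer.

Let L1_0 : L1 set0 = 0%E. Proof. exact: outer_measure0. Qed.

Let L1_ge0 A : (0 <= L1 A)%E. Proof. exact: outer_measure_ge0. Qed.

Let L1_semi_sigma_additive : semi_sigma_additive L1.
Proof. by move=> F mF tF mUF; exact: caratheodory_measure_sigma_additive. Qed.

HB.instance Definition _ :=
  isMeasure.Build _ _ _ L1 L1_0 L1_ge0 L1_semi_sigma_additive.

End BerarducciOtero.

Arguments BO_outer {L K} S R _.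
Arguments L1 {L K} S R _.

Section Whitney.
Context (R : realType) (L : signature) (K : rcfType) (S : expansion L K).

Definition unit_itv : set K := [set t | 0 <= t <= 1].

(* Only the restriction of gamma to [0, 1] matters. *)
Definition definable_curve n (gamma : K -> 'rV[K]_n) : Prop :=
  {within unit_itv, continuous gamma} /\
  definable S [set z : 'rV[K]_(1 + n) |
    unit_itv (lsubmx z 0 0) /\ rsubmx z = gamma (lsubmx z 0 0)].

(* Up to finitely many t, the integrand st |gamma'(t)| makes sense: the
   derivative exists (automatic for a definable gamma in an o-minimal structure)
   and is finite. Without finiteness a curve could move during an infinitesimal
   time without contributing to the integral. *)
Definition has_length n (gamma : K -> 'rV[K]_n) : Prop :=
  exists E : seq K, forall t, unit_itv t -> t \notin E ->
    derivable gamma t 1 /\ finite_elt (enorm (derive1 gamma t)).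

Definition curve_length n (gamma : K -> 'rV[K]_n) : \bar R :=
  (\int[L1 S R]_(t in (unit_itv : set (caratheodory_type (BO_outer S R))))
     (st R (enorm (derive1 gamma t)))%:E)%E.

Definition whitney_arc_property n (A : set 'rV[K]_n) : Prop :=
  exists c : K, [/\ finite_elt c, 0 < c &
    forall x y, A x -> A y ->
      exists gamma : K -> 'rV[K]_n,
        [/\ definable_curve gamma,
            forall t, unit_itv t -> A (gamma t),
            gamma 0 = x /\ gamma 1 = y,
            has_length gamma &
            (curve_length gamma <= (st R (c * enorm (x - y)))%:E)%E]].

End Whitney.

(* Main.v *)
(* By induction on the cell C there is a finite c such that any x, y in C are
   joined in C by a definable curve which is differentiable on (0, 1) with speed
   at most c |x - y|. A curve in the base of a graph is lifted by the function;
   as velocities are tangent, the speed grows by a factor at most 1 + M. Over a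
   band (f, h) the curve g is lifted by f(g t) + u(t) (h - f)(g t) with u affine
   and prescribed at the end points. To bound u' (h - f)(g t) one compares it
   with its value at t = 0, which uses that f and h vary by at most M c |x - y|
   along g: this is the mean value inequality for definable functions, the only
   place where o-minimality is needed. A pointwise bound on the speed outside
   {0, 1} bounds the length, because [0, 1] has outer measure at most 1 and points
   are null. *)
Require Import Defs.
From mathcomp Require Import all_boot all_order all_algebra.
From mathcomp Require Import all_classical all_reals all_analysis measurable_realfun ring lra.

Set Implicit Arguments.
Unset Strict Implicit.
Unset Printing Implicit Defensive.

Import Order.TTheory GRing.Theory Num.Theory.
Import numFieldNormedType.Exports.

Local Open Scope classical_set_scope.
Local Open Scope ring_scope.

(** * Definable predicates on assignments of variables *)

Section Definability.
Context (L : signature) (K : rcfType) (S : expansion L K).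

(** Predicates on assignments instead of sets of rows: connectives, quantifiers and substitutions
    can then be combined without tracking a dimension. *)
Definition env_definable (P : (nat -> K) -> Prop) : Prop :=
  exists p : formula L K, forall e, P e <-> sat S e p.

Definition upd (e : nat -> K) (i : nat) (a : K) : nat -> K :=
  fun j => if j == i then a else e j.

(** All variables of the term lie strictly below this number, which is therefore a fresh
    variable. *)
Fixpoint term_bound (t : term L K) : nat :=
  match t with
  | TVar i => i.+1
  | TPar _ => 0
  | TAdd t1 t2 | TMul t1 t2 => maxn (term_bound t1) (term_bound t2)
  | TFun f ts => \max_(i < farity f) term_bound (ts i)
  end.

Lemma teval_upd e w a t : (term_bound t <= w)%N ->
  teval S (upd e w a) t = teval S e t.
Proof.
elim: t => //= [i iw|t1 IH1 t2 IH2|t1 IH1 t2 IH2|f ts IH].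
- by rewrite /upd ltn_eqF.
- by rewrite geq_max => /andP[? ?]; rewrite IH1 ?IH2.
- by rewrite geq_max => /andP[? ?]; rewrite IH1 ?IH2.
- move=> /bigmax_leqP bw; congr (fint _); apply: funext => i.
  by apply: IH; exact: bw.
Qed.

Fixpoint tsubst (s : nat -> term L K) (t : term L K) : term L K :=
  match t with
  | TVar i => s i
  | TPar a => TPar L a
  | TAdd t1 t2 => TAdd (tsubst s t1) (tsubst s t2)
  | TMul t1 t2 => TMul (tsubst s t1) (tsubst s t2)
  | TFun f ts => TFun (fun i => tsubst s (ts i))
  end.

Lemma teval_tsubst e s t :
  teval S e (tsubst s t) = teval S (fun j => teval S e (s j)) t.
Proof.
elim: t => //= [t1 -> t2 ->|t1 -> t2 ->|f ts IH] //.
by congr (fint _); apply: funext => i; exact: IH.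
Qed.

(* The bound on s provides a fresh variable when passing under a quantifier. *)
Lemma env_definable_subst p (s : nat -> term L K) (B : nat) :
  (forall j, term_bound (s j) <= B)%N ->
  env_definable (fun e => sat S (fun j => teval S e (s j)) p).
Proof.
elim: p s B => [t1 t2|t1 t2|r ts|q IH|q1 IH1 q2 IH2|i q IH] s B sB.
- by exists (FEq (tsubst s t1) (tsubst s t2)) => e; rewrite /= !teval_tsubst.
- by exists (FLt (tsubst s t1) (tsubst s t2)) => e; rewrite /= !teval_tsubst.
- exists (FRel (fun i => tsubst s (ts i))) => e /=.
  suff -> : (fun i => teval S e (tsubst s (ts i))) =
    (fun i => teval S (fun j => teval S e (s j)) (ts i)) by [].
  by apply: funext => i; rewrite teval_tsubst.
- by have [p pE] := IH _ _ sB; exists (FNot p) => e /=; rewrite pE.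
- have [p1 pE1] := IH1 _ _ sB; have [p2 pE2] := IH2 _ _ sB.
  by exists (FAnd p1 p2) => e /=; rewrite pE1 pE2.
- pose s' j := if j == i then TVar L K B else s j.
  have [|p pE] := IH s' B.+1.
    by move=> j; rewrite /s'; case: ifP => //= _; exact: leqW.
  exists (FEx B p) => e /=.
  suff H a : (fun j => teval S (upd e B a) (s' j)) =
      (fun j => if j == i then a else teval S e (s j)).
    by split=> -[a]; [rewrite -H => /pE; exists a|move=> /pE; rewrite H; exists a].
  apply: funext => j; rewrite /s'; case: ifP => _ /=.
    by rewrite /upd eqxx.
  exact: teval_upd.
Qed.

Lemma env_definable_set n (A : set 'rV[K]_n) (s : 'I_n -> term L K) :
  definable S A -> env_definable (fun e => A (\row_i teval S e (s i))).
Proof.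
move=> [p ->].
(* The default 0 agrees with the dummy value that [point_env] gives to the variables from [n] on. *)
pose s' j := if insub j is Some i then s i else TPar L 0.
have [|q qE] := @env_definable_subst p s' (\max_(i < n) term_bound (s i))%N.
  move=> j; rewrite /s'; case: insub => //= i.
  exact: (leq_bigmax (F := fun i => term_bound (s i))).
exists q => e; rewrite -qE /= /holds.
suff -> : point_env (\row_i teval S e (s i)) = (fun j => teval S e (s' j)) by [].
apply: funext => j; rewrite /point_env /s'.
by case: insub => //= i; rewrite mxE.
Qed.

Lemma definable_env n (A : set 'rV[K]_n) P :
  env_definable P -> (forall x, A x <-> P (point_env x)) -> definable S A.
Proof.
move=> [p pE] AP; exists p; apply/seteqP.
by split=> x /=; rewrite AP pE.
Qed.

Lemma env_definable_iff P Q :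
  env_definable P -> (forall e, P e <-> Q e) -> env_definable Q.
Proof. by move=> [p pE] PQ; exists p => e; rewrite -PQ. Qed.

Lemma env_definable_eq t1 t2 :
  env_definable (fun e => teval S e t1 = teval S e t2).
Proof. by exists (FEq t1 t2). Qed.

Lemma env_definable_lt t1 t2 :
  env_definable (fun e => teval S e t1 < teval S e t2).
Proof. by exists (FLt t1 t2). Qed.

Lemma env_definable_not P : env_definable P -> env_definable (fun e => ~ P e).
Proof. by move=> [p pE]; exists (FNot p) => e; rewrite pE. Qed.

Lemma env_definable_and P Q : env_definable P -> env_definable Q ->
  env_definable (fun e => P e /\ Q e).
Proof. by move=> [p pE] [q qE]; exists (FAnd p q) => e; rewrite pE qE. Qed.

Lemma env_definable_le t1 t2 :
  env_definable (fun e => teval S e t1 <= teval S e t2).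
Proof.
apply: env_definable_iff (env_definable_not (env_definable_lt t2 t1)) _ => e.
by rewrite leNgt; split=> /negP.
Qed.

Lemma env_definable_ex i P : env_definable P ->
  env_definable (fun e => exists a, P (upd e i a)).
Proof.
move=> [p pE]; exists (FEx i p) => e /=.
by split=> -[a Pa]; exists a; apply/pE.
Qed.

Definition upd_block (e : nat -> K) (i m : nat) (v : nat -> K) : nat -> K :=
  fun j => if (i <= j < i + m)%N then v (j - i)%N else e j.

(** Quantification over a tuple whose length is a parameter, by induction on [m], splitting off the
    last variable [i + m]. The tuple is coded by a function on [nat] of which only the first [m]
    values matter. *)
Lemma env_definable_ex_block i m P : env_definable P ->
  env_definable (fun e => exists v : nat -> K, P (upd_block e i m v)).
Proof.
elim: m P => [|m IH] P defP.
  apply: env_definable_iff defP _ => e.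
  have E v : upd_block e i 0 v = e.
    apply: funext => j; rewrite /upd_block addn0.
    by case: ltnP; rewrite ?andbF // => ?; case: leqP.
  by split=> [Pe|[v]]; [exists (fun=> 0)|]; rewrite E.
have := IH _ (env_definable_ex (i + m) defP).
move=> /env_definable_iff; apply=> e.
have E v a : upd (upd_block e i m v) (i + m) a = upd_block e i m.+1 (upd v m a).
  apply: funext => j; rewrite /upd /upd_block addnS ltnS.
  have [->|jim] := eqVneq j (i + m)%N; first by rewrite leq_addr leqnn /= addKn eqxx.
  rewrite [(j <= _)%N]leq_eqVlt (negbTE jim) /=.
  case: ifP => // /andP[ij _].
  by rewrite -(inj_eq (@addnI i)) subnKC // (negbTE jim).
split=> [[v [a]]|[v Pv]].
  by rewrite E => ?; exists (upd v m a).
exists v, (v m); rewrite E; suff -> : upd v m (v m) = v by [].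
by apply: funext => j; rewrite /upd; case: eqP => // ->.
Qed.

End Definability.

(** * Continuity and derivatives in epsilon-delta form *)

Section EpsDelta.
Context (K : rcfType).

Lemma within_continuousP (V W : normedModType K) (A : set V) (f : V -> W) :
  {within A, continuous f} <->
  forall x, A x -> forall e : K, 0 < e -> exists2 d, 0 < d &
    forall y, A y -> `|y - x| < d -> `|f y - f x| < e.
Proof.
rewrite subspace_continuousP; split=> cf x Ax.
  move=> e e0; have /cvgrPdist_lt/(_ e e0) := cf x Ax.
  rewrite near_withinE near_nbhs => /nbhs_normP[d d0 dP]; exists d => // y Ay yx.
  rewrite distrC; apply: dP => //=.
  by rewrite distrC.
apply/cvgrPdist_lt => e e0; have [d d0 dP] := cf x Ax e e0.
rewrite near_withinE near_nbhs; apply/nbhs_normP; exists d => // y /= yx Ay.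
by rewrite distrC; apply: dP => //; rewrite distrC.
Qed.

(** The form without a quotient also makes sense at [h = 0], where it is trivial; this makes it
    convenient for chain rules and for arguments coordinate by coordinate. *)
Lemma is_derive_littleo (V : normedModType K) (f : K -> V) (t : K) (v : V) :
  is_derive t 1 f v <->
  forall e : K, 0 < e -> exists2 d, 0 < d &
    forall h, `|h| < d -> `|f (t + h) - f t - h *: v| <= e * `|h|.
Proof.
(* The difference quotient whose limit at 0 is the derivative in direction 1. *)
pose q (h : K) := h^-1 *: (f (h *: (1 : K) + t) - f t).
have qE h : h != 0 -> `|f (t + h) - f t - h *: v| = `|v - q h| * `|h|.
  move=> h0; rewrite mulrC -normrZ scalerBr scalerA divff // scale1r distrC.
  by rewrite [h *: (1 : K)]mulr1 (addrC h).
suff <- : q @ 0^' --> v <-> is_derive t 1 f v; last first.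
  split=> [qv|[df <-]] //.
  have df : derivable f t 1 by apply/cvg_ex; exists v.
  by split=> //; apply: cvg_lim.
split.
  move=> /cvgrPdist_le qv e e0.
  have /nbhs_ballP[d /= d0 dP] := qv e e0; exists d => // h hd.
  have [->|h0] := eqVneq h 0.
    by rewrite addr0 subrr scale0r subr0 !normr0 mulr0.
  rewrite qE // ler_wpM2r //; apply: dP => //.
  by rewrite /ball /= sub0r normrN.
move=> fP; apply/cvgrPdist_le => e e0; have [d d0 dP] := fP e e0.
apply/nbhs_ballP; exists d => //= h; rewrite /ball /= sub0r normrN => hd h0.
by rewrite -(ler_pM2r (_ : 0 < `|h|)) ?normr_gt0 // -qE // dP.
Qed.

End EpsDelta.

(** * Infima of definable sets *)

Section MeanValue.
Context (L : signature) (K : rcfType) (S : expansion L K).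

Definition is_glb (A : set K) (t : K) : Prop :=
  (forall x, A x -> t <= x) /\ forall d, t < d -> exists2 x, A x & x < d.

Lemma itv_glb (I : interval K) (b x : K) :
  x \in I -> (forall y, y \in I -> b <= y) -> exists t, is_glb [set` I] t.
Proof.
case: I => [[c l|[|]] u] xI bI.
- exists l; split=> [y /=|d ld].
    by rewrite itv_boundlr => /andP[+ _]; case: c {xI bI}; rewrite !bnd_simp // => /ltW.
  have lx : l <= x.
    by move: xI; rewrite itv_boundlr => /andP[+ _]; case: c {bI}; rewrite !bnd_simp // => /ltW.
  case: c xI {bI} => xI.
    exists l => //=; move: xI; rewrite !itv_boundlr !bnd_simp /=.
    by move=> /andP[_]; apply: le_trans; rewrite bnd_simp.
  (* The left end [l] is excluded here, so a point of the interval below [d] is needed: the midpoint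
     of [l] and [d], capped by [x] so as not to pass the right end. *)
  pose m := Num.min x ((l + d) / 2%:R).
  have xl : l < x by move: xI; rewrite itv_boundlr => /andP[]; rewrite bnd_simp.
  exists m; last by rewrite /m gt_min (midf_lt ld).2 orbT.
  rewrite /= itv_boundlr bnd_simp lt_min xl (midf_lt ld).1 /=.
  move: xI; rewrite itv_boundlr => /andP[_]; apply: le_trans.
  by rewrite bnd_simp ge_min lexx.
(* Without a left end the interval would contain points below [b]. *)
- have := bI (Num.min x (b - 1)); rewrite le_min.
  suff -> : Num.min x (b - 1) \in Interval -oo%O u.
    by move=> /(_ isT) /andP[_]; rewrite lerDl oppr_ge0 ler10.
  move: xI; rewrite !itv_boundlr !bnd_simp /=; apply: le_trans.
  by rewrite bnd_simp ge_min lexx.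
- by move: xI; rewrite itv_boundlr.
Qed.

(** O-minimality replaces completeness: the set is a finite union of intervals, a nonempty interval
    bounded below has its left end as infimum, and the infimum of a union is the smaller of the two
    infima. Empty pieces have no infimum and are discarded first. *)
Lemma definable_glb (A : set K) (b : K) : o_minimal S -> definable1 S A ->
  A !=set0 -> (forall x, A x -> b <= x) -> exists t, is_glb A t.
Proof.
move=> omin defA; have [s ->] := omin A defA.
elim: s => [|I s IH]; first by move=> [x []].
rewrite [X in bigcup X _](_ : _ = I |` [set` s]); last first.
  by apply/seteqP; split=> J /=; rewrite in_cons => /predU1P.
rewrite bigcup_setU1; set U := bigcup _ _ in IH *.
have [[y yU]|U0] := pselect (U !=set0); last first.
  move=> [x [xI|Ux]] bx; last by case: U0; exists x.
  have -> : [set` I] `|` U = [set` I].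
    by apply/seteqP; split=> z; [case=> // Uz; case: U0; exists z|left].
  by apply: itv_glb xI _ => y yI; apply: bx; left.
have [[x xI]|I0] := pselect ([set` I] !=set0); last first.
  have -> : [set` I] `|` U = U.
    by apply/seteqP; split=> z; [case=> // Iz; case: I0; exists z|right].
  by move=> _; apply: IH; exists y.
move=> _ bx.
have [t tI] : exists t, is_glb [set` I] t.
  by apply: itv_glb xI _ => z zI; apply: bx; left.
have [u uU] : exists u, is_glb U u.
  by apply: IH => [|z zU]; [exists y|apply: bx; right].
exists (Num.min t u); split=> [z [/tI.1|/uU.1]|d].
- by rewrite ge_min => ->.
- by rewrite ge_min => ->; rewrite orbT.
- by rewrite gt_min => /orP[/tI.2|/uU.2] [z Az zd]; exists z => //; [left|right].
Qed.

End MeanValue.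

(** * The mean value inequality for definable functions *)

Section DefinableMeanValue.
Context (L : signature) (K : rcfType) (S : expansion L K).

Lemma point_envE n (x : 'rV[K]_n) (i : 'I_n) : point_env x i = x 0 i.
Proof. by rewrite /point_env valK. Qed.

Lemma env_definable_or P Q : env_definable S P -> env_definable S Q ->
  env_definable S (fun e => P e \/ Q e).
Proof.
move=> dP dQ; apply: env_definable_iff
  (env_definable_not (env_definable_and (env_definable_not dP) (env_definable_not dQ))) _.
by move=> e; rewrite -not_orE; split=> [/contrapT|?].
Qed.

Definition curve_definable (phi : K -> K) : Prop :=
  env_definable S (fun e => unit_itv (e 0%N) /\ e 1%N = phi (e 0%N)).

(** Let [tau] be the infimum of the points from [a] on where the bound fails. If it fails at [tau],
    it fails a little earlier by continuity; if it holds at [tau], the derivative there preserves it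
    a little further. The margin [B < C] absorbs the error of the first-order expansion, and [0 < a]
    keeps [tau] in the open interval where the derivative exists. *)
Lemma mean_value_from (phi : K -> K) (B C a t : K) : o_minimal S ->
  curve_definable phi -> {within @unit_itv K, continuous phi} ->
  (forall t : K, 0 < t < 1 -> exists2 d, is_derive t 1 phi d & `|d| <= B) ->
  0 <= B -> B < C -> 0 < a -> a <= t -> t <= 1 ->
  `|phi t - phi a| <= C * (t - a).
Proof.
move=> omin dphi /within_continuousP cphi phi' B0 BC a0 at_ t1.
pose A := [set t | [/\ 0 <= t <= 1, a <= t & C * (t - a) < `|phi t - phi a|]].
rewrite leNgt; apply/negP => Ct.
have At : A t by split=> //; rewrite t1 (le_trans (ltW a0)).
have defA : definable1 S A.
  (* The value of [phi] is put in the variable 1 and quantified away; the absolute value is written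
     as a disjunction of two strict inequalities. *)
  pose V := TVar L K; pose P := @TPar L K.
  pose rhs := TMul (P C) (TAdd (V 0%N) (P (- a))).
  have H := env_definable_ex 1 (env_definable_and dphi (env_definable_and
    (env_definable_le S (P a) (V 0%N)) (env_definable_or
      (env_definable_lt S rhs (TAdd (V 1%N) (P (- phi a))))
      (env_definable_lt S rhs (TAdd (P (phi a)) (TMul (P (-1)) (V 1%N))))))).
  apply: definable_env H _ => x /=.
  rewrite /upd /= -[0%N]/(@ord0 0 : nat) point_envE.
  set s := x 0 ord0.
  rewrite /A /= ltr_normr opprB; split.
    move=> [s01 as_ /orP H]; exists (phi s); do !split=> //.
    by case: H => ?; [left|right; rewrite mulN1r].
  move=> [_ [[s01 ->] [as_ H]]]; split=> //; apply/orP.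
  by case: H; rewrite ?mulN1r => ?; [left|right].
have [tau [tauA Atau]] : exists tau, is_glb A tau.
  by apply: (definable_glb (b := a)) omin defA _ _; [exists t|move=> x []].
have atau : a <= tau.
  by rewrite leNgt; apply/negP => /Atau[x [_ ax _]]; rewrite ltNge ax.
have taut := tauA t At.
(* First case: the bound fails at [tau]. The point [s] below lies to the left of [tau], not before
   [a], and so close to [tau] that the bound still fails. *)
have [[tau01 _ Ctau]|NAtau] := pselect (A tau).
  have {atau}atau : a < tau.
    rewrite lt_neqAle atau andbT; apply/eqP => E.
    by move: Ctau; rewrite -E !subrr normr0 mulr0 ltxx.
  have e0 : 0 < `|phi tau - phi a| - C * (tau - a) by rewrite subr_gt0.
  have [d d0 dP] := cphi tau tau01 _ e0.
  pose s := Num.max ((a + tau) / 2%:R) (tau - d / 2%:R).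
  have stau : s < tau.
    by rewrite gt_max (midf_lt atau).2 ltrBlDr ltrDl divr_gt0.
  have as_ : a <= s by rewrite le_max (ltW (midf_lt atau).1).
  have s01 : unit_itv s.
    rewrite /unit_itv /= (le_trans (ltW a0) as_).
    by rewrite (le_trans (ltW stau)) // (le_trans taut).
  have sd : `|s - tau| < d.
    rewrite distrC gtr0_norm ?subr_gt0 // ltrBlDr -ltrBlDl.
    apply: lt_le_trans (_ : tau - d / 2%:R <= _); last by rewrite le_max lexx orbT.
    by rewrite ltrD2l ltrN2 ltr_pdivrMr // mulr_natr mulr2n ltrDl.
  have sA : ~ A s by move=> /tauA; rewrite leNgt stau.
  apply: sA; split=> //; have := dP s s01 sd; rewrite distrC => H.
  have := ler_distD (phi s) (phi tau) (phi a) => H2.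
  have : C * (s - a) <= C * (tau - a).
    by rewrite ler_wpM2l ?(le_trans B0 (ltW BC)) // lerD2r ltW.
  by move: H H2; lra.
(* Second case: the bound holds at [tau]. It then extends with slope [B + (C - B)] to all points of
   [0, 1] within [d] to the right, yet one of these belongs to [A]. *)
have Ctau : `|phi tau - phi a| <= C * (tau - a).
  rewrite leNgt; apply/negP => H; apply: NAtau; split=> //.
  by rewrite (le_trans (ltW a0) atau) (le_trans taut).
have tau1 : tau < 1.
  apply: lt_le_trans t1; rewrite lt_neqAle taut andbT; apply/eqP => E.
  by apply: NAtau; rewrite E.
have [|v phiv vB] := phi' tau; first by rewrite tau1 (lt_le_trans a0).
have /is_derive_littleo/(_ (C - B)) := phiv; rewrite subr_gt0 => /(_ BC)[d d0 dP].
have [x Ax xd] : exists2 x, A x & x < tau + d by apply: Atau; rewrite ltrDl.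
have taux := tauA x Ax; have [_ _] := Ax; rewrite ltNge => /negP; apply.
have := dP (x - tau); rewrite ger0_norm ?subr_ge0 // ltrBlDl => /(_ xd).
rewrite [tau + _]addrC subrK => H.
have := ler_distD (phi tau) (phi x) (phi a) => H2.
have : `|phi x - phi tau| <= `|phi x - phi tau - (x - tau) *: v| + `|(x - tau) *: v|.
  by rewrite -{1}[phi x - phi tau](subrK ((x - tau) *: v)) ler_normD.
rewrite normrZ (ger0_norm (_ : 0 <= x - tau)) ?subr_ge0 // => H3.
have : (x - tau) * `|v| <= (x - tau) * B by rewrite ler_wpM2l ?subr_ge0.
by move: H H2 H3 Ctau; nra.
Qed.

(** With [e] half of a supposed excess, the previous bound is applied with slope [B + e] from a
    point [a] where [phi] is within [e] of its value at 0. As [t <= 1], each of the two changes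
    costs at most [e], and the second cost is strictly smaller. *)
Lemma mean_value (phi : K -> K) (B t : K) : o_minimal S ->
  curve_definable phi -> {within @unit_itv K, continuous phi} ->
  (forall t : K, 0 < t < 1 -> exists2 d, is_derive t 1 phi d & `|d| <= B) ->
  unit_itv t -> `|phi t - phi 0| <= B * t.
Proof.
move=> omin dphi cphi phi' /andP[]; rewrite le_eqVlt => /predU1P[<- _|t0 t1].
  by rewrite subrr normr0 mulr0.
have B0 : 0 <= B.
  have [|d _ /(le_trans (normr_ge0 _)) //] := phi' (2%:R^-1).
  by rewrite invr_gt0 ltr0n invf_lt1 ?ltr1n ?ltr0n.
rewrite leNgt; apply/negP => Bt; pose e := (`|phi t - phi 0| - B * t) / 2%:R.
have e0 : 0 < e by rewrite divr_gt0 // subr_gt0.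
have [|d d0 dP] := (within_continuousP _ _).1 cphi 0 _ e e0.
  by rewrite /unit_itv /= lexx ler01.
pose a := Num.min t (d / 2%:R).
have a0 : 0 < a by rewrite lt_min t0 divr_gt0.
have at_ : a <= t by rewrite ge_min lexx.
have ad : `|a - 0| < d.
  rewrite subr0 gtr0_norm // gt_min; apply/orP; right.
  by rewrite ltr_pdivrMr // mulr_natr mulr2n ltrDl.
have := dP a _ ad; rewrite /unit_itv /= ltW // (le_trans at_) // => /(_ isT) H.
have BC : B < B + e by rewrite ltrDl.
have := mean_value_from omin dphi cphi phi' B0 BC a0 at_ t1 => H2.
have := ler_distD (phi a) (phi t) (phi 0) => H3.
have : (B + e) * (t - a) <= B * t + e by nra.
by move: H H2 H3; rewrite /e; lra.
Qed.

End DefinableMeanValue.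

(** * Row vectors: Euclidean norm, sup norm, and adjoining a last coordinate *)

Section RowVectors.
Context (K : rcfType).

Lemma coord_le_norm n (v : 'rV[K]_n) i : `|v 0 i| <= `|v|.
Proof.
rewrite [leRHS]/Num.norm /= mx_normrE.
exact: (le_bigmax _ (fun ij : 'I_1 * 'I_n => `|v ij.1 ij.2|) (0, i)).
Qed.

Lemma row_norm_le n (v : 'rV[K]_n) (B : K) :
  0 <= B -> (forall i, `|v 0 i| <= B) -> `|v| <= B.
Proof.
move=> B0 vB; rewrite [leLHS]/Num.norm /= mx_normrE.
by apply/bigmax_leP; split=> // -[i j] _ /=; rewrite ord1.
Qed.

Lemma enorm_ge0 n (v : 'rV[K]_n) : 0 <= enorm v.
Proof. exact: sqrtr_ge0. Qed.

Lemma sqr_enorm n (v : 'rV[K]_n) : enorm v ^+ 2 = \sum_i v 0 i ^+ 2.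
Proof. by rewrite sqr_sqrtr // sumr_ge0 // => i _; rewrite sqr_ge0. Qed.

Lemma sqr_enorm_last n (v : 'rV[K]_n.+1) :
  enorm v ^+ 2 = enorm (col' ord_max v) ^+ 2 + v 0 ord_max ^+ 2.
Proof.
rewrite !sqr_enorm big_ord_recr /=; congr (_ + _); apply: eq_bigr => i _.
by rewrite mxE; congr (v 0 _ ^+ 2); apply: val_inj; rewrite /= /bump leqNgt ltn_ord.
Qed.

Lemma enorm_col'_le n (v : 'rV[K]_n.+1) : enorm (col' ord_max v) <= enorm v.
Proof.
rewrite -(@ler_pXn2r _ 2) ?nnegrE ?enorm_ge0 // sqr_enorm_last.
by rewrite lerDl sqr_ge0.
Qed.

Lemma enorm_col'B_le n (v w : 'rV[K]_n.+1) :
  enorm (col' ord_max v - col' ord_max w) <= enorm (v - w).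
Proof. by have := enorm_col'_le (v - w); rewrite raddfB. Qed.

Lemma last_le_enorm n (v : 'rV[K]_n.+1) : `|v 0 ord_max| <= enorm v.
Proof.
rewrite -(@ler_pXn2r _ 2) ?nnegrE ?enorm_ge0 // sqr_enorm_last.
by rewrite real_normK ?num_real // lerDr sqr_ge0.
Qed.

Lemma enorm_le_last n (v : 'rV[K]_n.+1) :
  enorm v <= enorm (col' ord_max v) + `|v 0 ord_max|.
Proof.
have c0 := enorm_ge0 (col' ord_max v).
rewrite -(@ler_pXn2r _ 2) ?nnegrE ?enorm_ge0 ?addr_ge0 // sqr_enorm_last sqrrD.
by rewrite real_normK ?num_real // lerD2r lerDl mulrn_wge0 ?mulr_ge0.
Qed.

Lemma enorm_le_sum n (v : 'rV[K]_n) : enorm v <= \sum_i `|v 0 i|.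
Proof.
elim: n v => [|n IH] v.
  by rewrite /enorm !big_ord0 sqrtr0.
apply: le_trans (enorm_le_last v) _; rewrite big_ord_recr /= lerD2r.
apply: le_trans (IH _) _; rewrite le_eqVlt; apply/orP; left; apply/eqP.
apply: eq_bigr => i _; rewrite mxE; congr `|v 0 _|.
by apply: val_inj; rewrite /= /bump leqNgt ltn_ord.
Qed.

(** The factor is crude, but it serves only to translate first-order expansions from the Euclidean
    norm to the sup norm, which defines the topology. *)
Lemma enorm_le_norm n (v : 'rV[K]_n) : enorm v <= n%:R * `|v|.
Proof.
apply: le_trans (enorm_le_sum v) _.
rewrite mulr_natl -[leRHS](_ : \sum_(i < n) `|v| = _); last first.
  by rewrite sumr_const card_ord.
by apply: ler_sum => i _; exact: coord_le_norm.
Qed.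

Lemma mulmx_col_le n (v : 'rV[K]_n) (a : 'cV[K]_n) :
  `|(v *m a) 0 0| <= `|v| * \sum_i `|a i 0|.
Proof.
rewrite mxE mulr_sumr; apply: le_trans (ler_norm_sum _ _ _) _.
by apply: ler_sum => i _; rewrite normrM ler_wpM2r // coord_le_norm.
Qed.

(** The inverse of the splitting into [col' ord_max] and the entry at [ord_max], by which graphs and
    bands are defined. *)
Definition snoc_row n (v : 'rV[K]_n) (a : K) : 'rV[K]_n.+1 :=
  \row_i if unlift ord_max i is Some j then v 0 j else a.

Lemma snoc_row_last n (v : 'rV[K]_n) a : snoc_row v a 0 ord_max = a.
Proof. by rewrite mxE unlift_none. Qed.

Lemma snoc_row_lift n (v : 'rV[K]_n) a j :
  snoc_row v a 0 (lift ord_max j) = v 0 j.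
Proof. by rewrite mxE liftK. Qed.

Lemma col'_snoc_row n (v : 'rV[K]_n) a : col' ord_max (snoc_row v a) = v.
Proof. by apply/rowP => j; rewrite mxE snoc_row_lift. Qed.

Lemma row_lastP n (v w : 'rV[K]_n.+1) :
  col' ord_max v = col' ord_max w -> v 0 ord_max = w 0 ord_max -> v = w.
Proof.
move=> /rowP c l; apply/rowP => i; case: (unliftP ord_max i) => [j|] -> //.
by have := c j; rewrite !mxE.
Qed.

Lemma snoc_row_norm_le n (v : 'rV[K]_n.+1) (B : K) : 0 <= B ->
  `|col' ord_max v| <= B -> `|v 0 ord_max| <= B -> `|v| <= B.
Proof.
move=> B0 cB lB; apply: row_norm_le => // i.
case: (unliftP ord_max i) => [j|] -> //.
by apply: le_trans cB; have := coord_le_norm (col' ord_max v) j; rewrite mxE.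
Qed.

Lemma within_continuous_snoc_row n (A : set K) (g : K -> 'rV[K]_n) (phi : K -> K) :
  {within A, continuous g} -> {within A, continuous phi} ->
  {within A, continuous (fun t => snoc_row (g t) (phi t))}.
Proof.
move=> /within_continuousP cg /within_continuousP cphi; apply/within_continuousP.
move=> x Ax e e0; have e20 : 0 < e / 2%:R by rewrite divr_gt0.
have [d1 d10 H1] := cg x Ax _ e20; have [d2 d20 H2] := cphi x Ax _ e20.
exists (Num.min d1 d2) => [|y Ay]; first by rewrite lt_min d10.
rewrite lt_min => /andP[/(H1 _ Ay)/ltW h1 /(H2 _ Ay)/ltW h2].
apply: le_lt_trans (_ : e / 2%:R < e); last first.
  by rewrite ltr_pdivrMr // mulr_natr mulr2n ltrDl.
apply: snoc_row_norm_le; first exact: ltW.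
  by rewrite raddfB /= !col'_snoc_row.
by rewrite !mxE !unlift_none.
Qed.

Lemma is_derive_snoc_row n (g : K -> 'rV[K]_n) (phi : K -> K) (t : K) v a :
  is_derive t 1 g v -> is_derive t 1 phi a ->
  is_derive t 1 (fun s => snoc_row (g s) (phi s)) (snoc_row v a).
Proof.
move=> /is_derive_littleo g' /is_derive_littleo phi'; apply/is_derive_littleo.
move=> e e0; have [d1 d10 H1] := g' e e0; have [d2 d20 H2] := phi' e e0.
exists (Num.min d1 d2) => [|h]; first by rewrite lt_min d10.
rewrite lt_min => /andP[/H1 h1 /H2 h2].
apply: snoc_row_norm_le; first by rewrite mulr_ge0 // ltW.
  suff -> : col' ord_max (snoc_row (g (t + h)) (phi (t + h)) -
    snoc_row (g t) (phi t) - h *: snoc_row v a) = g (t + h) - g t - h *: v by [].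
  by apply/rowP => j; rewrite !mxE !liftK.
by rewrite !mxE !unlift_none.
Qed.

End RowVectors.

(** * Differentials along a set and the chain rule for curves in it *)

Section DifferentialAlong.
Context (K : rcfType) (m : nat) (X : set 'rV[K]_m) (f : 'rV[K]_m -> K).

Lemma differential_onP x (a : 'cV[K]_m) : differential_on X f x a ->
  forall e, 0 < e -> exists2 d, 0 < d & forall y, X y -> `|y - x| < d ->
    `|f y - f x - ((y - x) *m a) 0 0| <= e * `|y - x|.
Proof.
(* The successor keeps the divisor positive when [m = 0]. *)
move=> fa e e0; have m0 : 0 < m.+1%:R :> K by rewrite ltr0n.
have := fa (e / m.+1%:R); rewrite divr_gt0 // => /(_ isT).
rewrite near_withinE near_nbhs => /nbhs_normP[d d0 dP]; exists d => // y Xy yx.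
have /dP/(_ Xy) : `|x - y| < d by rewrite distrC.
move=> /le_trans; apply; rewrite -mulrA ler_pM2l // ler_pdivrMl //.
apply: le_trans (enorm_le_norm _) _.
by rewrite ler_wpM2r // ler_nat.
Qed.

(** The first-order expansion with error factor 1 gives [|f y - f x| <= C |y - x|] for [y] near [x],
    with [C] one more than the sum of the absolute values of the entries of the covector. *)
Lemma within_continuous_differential (A : 'rV[K]_m -> 'cV[K]_m) :
  (forall x, X x -> differential_on X f x (A x)) -> {within X, continuous f}.
Proof.
move=> fA; apply/within_continuousP => x Xx e e0.
have [d d0 dP] := differential_onP (fA x Xx) ltr01.
pose C := 1 + \sum_i `|A x i 0|.
have C0 : 0 < C by rewrite ltr_pwDl ?sumr_ge0.
exists (Num.min d (e / C)) => [|y Xy].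
  by rewrite lt_min d0 divr_gt0.
rewrite lt_min ltr_pdivlMr // => /andP[/(dP _ Xy) H1]; apply: le_lt_trans.
have := mulmx_col_le (y - x) (A x) => H2.
rewrite -[f y - f x](subrK (((y - x) *m A x) 0 0)).
apply: le_trans (ler_normD _ _) _.
by rewrite /C mulrDr mulr1; apply: lerD => //; rewrite mul1r in H1.
Qed.

(** The chain rule. As [f] is differentiable only along [X], the curve has to stay in [X] for
    parameters near [t]. *)
Lemma is_derive_along (g : K -> 'rV[K]_m) (t : K) v (a : 'cV[K]_m) :
  (\forall h \near 0, X (g (t + h))) ->
  is_derive t 1 g v -> differential_on X f (g t) a ->
  is_derive t 1 (f \o g) ((v *m a) 0 0).
Proof.
move=> /nbhs_normP[d0 /= d00 Xg] /is_derive_littleo g' /differential_onP fa.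
apply/is_derive_littleo => e e0.
(* The error [e] is shared equally: one half for the expansion of [f], divided by the local
   Lipschitz constant [V] of [g], and one half for that of [g], divided by the size [Sa] of the
   covector. Adding 1 makes both divisors positive, and [V] comes from the expansion of [g] with
   error factor 1. *)
pose Sa := 1 + \sum_i `|a i 0|; pose V := 1 + `|v|.
have Sa0 : 0 < Sa by rewrite ltr_pwDl ?sumr_ge0.
have V0 : 0 < V by rewrite ltr_pwDl.
have e20 : 0 < e / 2%:R by rewrite divr_gt0.
have [d1 d10 H1] := fa _ (divr_gt0 e20 V0).
have [d2 d20 H2] := g' _ (divr_gt0 e20 Sa0).
have [d3 d30 H3] := g' _ ltr01.
exists (Num.min (Num.min d0 (d1 / V)) (Num.min d2 d3)) => [|h].
  by rewrite !lt_min d00 d20 d30 divr_gt0.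
rewrite !lt_min => /andP[/andP[hd0 hd1] /andP[/H2 {}H2 /H3 {}H3]].
have Xh : X (g (t + h)) by apply: Xg; rewrite /= sub0r normrN.
have gV : `|g (t + h) - g t| <= V * `|h|.
  rewrite -[g (t + h) - g t](subrK (h *: v)).
  by rewrite (le_trans (ler_normD _ _)) // /V mulrDl normrZ [`|h| * _]mulrC lerD2r.
have {}H1 := H1 _ Xh (le_lt_trans gV _).
rewrite mulrC -ltr_pdivlMr // in H1.
have {H1 hd1} := H1 hd1 => H1.
have E : f (g (t + h)) - f (g t) - h *: (v *m a) 0 0 =
    (f (g (t + h)) - f (g t) - ((g (t + h) - g t) *m a) 0 0) +
    ((g (t + h) - g t - h *: v) *m a) 0 0.
  rewrite [X in _ = _ + X](_ : _ = ((g (t + h) - g t) *m a) 0 0 - h *: (v *m a) 0 0).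
    by rewrite addrA subrK.
  by rewrite mulmxBl -scalemxAl !mxE.
rewrite /= E; apply: le_trans (ler_normD _ _) _.
rewrite [leRHS](_ : _ = e / 2%:R / V * (V * `|h|) + e / 2%:R / Sa * `|h| * Sa); last first.
  by field; rewrite !gt_eqF.
apply: lerD.
  by apply: le_trans H1 _; rewrite ler_wpM2l // ltW // divr_gt0.
apply: le_trans (mulmx_col_le _ _) _; apply: ler_pM => //.
  by rewrite sumr_ge0.
by rewrite lerDr.
Qed.

Lemma tangent_velocity (g : K -> 'rV[K]_m) (t : K) v :
  (\forall h \near 0, X (g (t + h))) -> is_derive t 1 g v -> tangent X (g t) v.
Proof.
move=> Xg /is_derive_littleo g'; exists (fun h => g (t + h)).
split=> //; first by rewrite addr0.
apply/is_derive_littleo => e /g'[d d0 dP]; exists d => // h /dP.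
by rewrite addr0 add0r.
Qed.

End DifferentialAlong.

(** * Definability of curves and of functions along them *)

Section DefinableCurves.
Context (L : signature) (K : rcfType) (S : expansion L K).

(** Moves a graph to arbitrary variables, so that several functions can be described over the same
    assignment. *)
Lemma curve_definable_terms (phi : K -> K) t1 t2 : curve_definable S phi ->
  env_definable S (fun e => unit_itv (teval S e t1) /\
                            teval S e t2 = phi (teval S e t1)).
Proof.
move=> [p pE]; pose s j := nth (TPar L 0) [:: t1; t2] j.
have [|q qE] := @env_definable_subst _ _ S p s
    (maxn (term_bound t1) (term_bound t2)).
  case=> [|[|j]]; rewrite /s /= ?leq_maxl ?leq_maxr // nth_nil //.
by exists q => e; rewrite -qE -pE.
Qed.

Lemma definable_curve_terms n (g : K -> 'rV[K]_n) t1 (s : 'I_n -> term L K) :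
  definable_curve S g ->
  env_definable S (fun e => unit_itv (teval S e t1) /\
                            \row_j teval S e (s j) = g (teval S e t1)).
Proof.
move=> [_ defg]; pose sg (i : 'I_(1 + n)) :=
  match fintype.split i with inl _ => t1 | inr j => s j end.
apply: env_definable_iff (env_definable_set sg defg) _ => e /=.
rewrite !mxE /sg (unsplitK (inl _ 0)).
suff -> : rsubmx (\row_i teval S e (sg i)) = \row_j teval S e (s j) by [].
by apply/rowP => j; rewrite !mxE /sg (unsplitK (inr _ j)).
Qed.

Lemma definable_curve_env n (g : K -> 'rV[K]_n) :
  {within @unit_itv K, continuous g} ->
  env_definable S (fun e => unit_itv (e 0%N) /\
                            \row_j e j.+1 = g (e 0%N)) ->
  definable_curve S g.
Proof.
move=> cg defg; split=> //; apply: definable_env defg _ => z /=.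
have -> : point_env z 0 = lsubmx z 0 0.
  by rewrite mxE -point_envE.
suff -> : \row_j point_env z (nat_of_ord j).+1 = rsubmx z by [].
by apply/rowP => j; rewrite !mxE -point_envE.
Qed.

Lemma definable_fun_terms m (X : set 'rV[K]_m) f (s : 'I_m -> term L K) t :
  definable_fun S X f ->
  env_definable S (fun e => X (\row_j teval S e (s j)) /\
                            teval S e t = f (\row_j teval S e (s j))).
Proof.
pose sg i := if unlift ord_max i is Some j then s j else t.
move=> /(env_definable_set sg) /env_definable_iff; apply=> e.
rewrite /graph_over /= mxE /sg unlift_none.
suff -> : col' ord_max (\row_i teval S e (sg i)) = \row_j teval S e (s j) by [].
by apply/rowP => j; rewrite !mxE /sg liftK.
Qed.

(** Composition of relations: the point [g t] is quantified away between the graph of [g] and that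
    of [f]. The latter lies over [X] only, whence the condition on the values of [g]. *)
Lemma curve_definable_comp m (X : set 'rV[K]_m) f (g : K -> 'rV[K]_m) :
  definable_fun S X f -> definable_curve S g ->
  (forall t, unit_itv t -> X (g t)) -> curve_definable S (f \o g).
Proof.
(* The variables 0 and 1 hold the parameter and the value; the intermediate point takes the [m]
   variables from 2 on. *)
move=> deff defg Xg; pose V := TVar L K; pose s (j : 'I_m) := V (2 + j)%N.
have H := env_definable_ex_block 2 m (env_definable_and
  (definable_curve_terms (V 0%N) s defg) (definable_fun_terms s (V 1%N) deff)).
apply: env_definable_iff H _ => e.
have E v : \row_j teval S (upd_block e 2 m v) (s j) = \row_j v j.
  apply/rowP => j; rewrite !mxE /= /upd_block leq_addr /= ltn_add2l ltn_ord.
  by rewrite addKn.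
have E0 v : teval S (upd_block e 2 m v) (V 0%N) = e 0%N by [].
have E1 v : teval S (upd_block e 2 m v) (V 1%N) = e 1%N by [].
split=> [[v]|[e01 e1]].
  by rewrite E E0 E1 /= => -[[? ->] [_ ->]].
exists (point_env (g (e 0%N))); rewrite E E0 E1.
suff -> : \row_j point_env (g (e 0%N)) (nat_of_ord j) = g (e 0%N).
  by do !split=> //; exact: Xg.
by apply/rowP => j; rewrite mxE point_envE.
Qed.

Lemma definable_curve_snoc_row m (g : K -> 'rV[K]_m) (phi : K -> K) :
  definable_curve S g -> {within @unit_itv K, continuous phi} ->
  curve_definable S phi -> definable_curve S (fun t => snoc_row (g t) (phi t)).
Proof.
move=> defg cphi defphi; apply: definable_curve_env.
  by apply: within_continuous_snoc_row => //; case: defg.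
pose V := TVar L K; pose s (j : 'I_m) := V j.+1.
apply: env_definable_iff (env_definable_and
  (definable_curve_terms (V 0%N) s defg)
  (curve_definable_terms (V 0%N) (V m.+1) defphi)) _ => e /=.
split=> [[[e01 gE] [_ phiE]]|[e01 snE]].
  split=> //; apply: row_lastP; last by rewrite snoc_row_last mxE.
  rewrite col'_snoc_row -gE; apply/rowP => j; rewrite !mxE /=.
  by rewrite /bump leqNgt ltn_ord.
do !split=> //.
  rewrite -[RHS](col'_snoc_row _ (phi (e 0%N))) -snE.
  by apply/rowP => j; rewrite !mxE /= /bump leqNgt ltn_ord.
by rewrite -[RHS](snoc_row_last (g (e 0%N))) -snE mxE.
Qed.

(** The formula for the height of a lifted curve over a band, at the affine relative height
    [a + b * t] between [phi] and [psi]. *)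
Lemma curve_definable_convex (phi psi : K -> K) (a b : K) :
  curve_definable S phi -> curve_definable S psi ->
  curve_definable S (fun t => phi t + (a + b * t) * (psi t - phi t)).
Proof.
move=> defphi defpsi; pose V := TVar L K; pose P := @TPar L K.
pose T := TAdd (V 2%N) (TMul (TAdd (P a) (TMul (P b) (V 0%N)))
  (TAdd (V 3%N) (TMul (P (-1)) (V 2%N)))).
have H := env_definable_ex 2 (env_definable_ex 3 (env_definable_and
  (env_definable_and (curve_definable_terms (V 0%N) (V 2%N) defphi)
    (curve_definable_terms (V 0%N) (V 3%N) defpsi))
  (env_definable_eq S (V 1%N) T))).
apply: env_definable_iff H _ => e; rewrite /upd /=.
split=> [[p [q [[[e01 pE] [_ qE]] ->]]]|[e01 ->]].
  by rewrite -pE -qE mulN1r.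
by exists (phi (e 0%N)), (psi (e 0%N)); rewrite mulN1r.
Qed.

Lemma definable_segment (a b : K) :
  definable_curve S (fun t => (a + b * t)%:M : 'rV[K]_1).
Proof.
apply: definable_curve_env.
  apply/within_continuousP => x _ e e0.
  pose C := 1 + `|b|; have C0 : 0 < C by rewrite ltr_pwDl.
  exists (e / C); first by rewrite divr_gt0.
  move=> y _; rewrite ltr_pdivlMr //; apply: le_lt_trans.
  apply: row_norm_le => [|i]; first by rewrite mulr_ge0 // ltW.
  rewrite !mxE !ord1 eqxx !mulr1n opprD addrACA subrr add0r -mulrBr normrM mulrC.
  by rewrite ler_wpM2l // /C lerDr.
pose V := TVar L K; pose P := @TPar L K.
apply: env_definable_iff (env_definable_and (env_definable_and
  (env_definable_le S (P 0) (V 0%N)) (env_definable_le S (V 0%N) (P 1)))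
  (env_definable_eq S (V 1%N) (TAdd (P a) (TMul (P b) (V 0%N))))) _ => e /=.
split=> [[[? ?] e1]|[/andP[? ?] /rowP/(_ 0)]].
  by split; [apply/andP|apply/rowP => i; rewrite !mxE !ord1 eqxx mulr1n].
by rewrite !mxE eqxx mulr1n.
Qed.

Lemma is_derive_segment (a b t : K) :
  is_derive t 1 (fun t => (a + b * t)%:M : 'rV[K]_1) b%:M.
Proof.
apply/is_derive_littleo => e e0; exists 1 => // h _.
rewrite -raddfB scale_scalar_mx -raddfB /= [X in X%:M](_ : _ = 0); last by ring.
by rewrite raddf0 normr0 mulr_ge0 // ltW.
Qed.

End DefinableCurves.

(** * Curves of bounded speed in cells *)

Section CellCurves.
Context (L : signature) (K : rcfType) (S : expansion L K).

Lemma finite_elt_nat (k : nat) : finite_elt (k%:R : K).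
Proof. by exists k; rewrite ger0_norm. Qed.

Lemma finite_eltD (x y : K) : finite_elt x -> finite_elt y -> finite_elt (x + y).
Proof.
move=> [k xk] [l yl]; exists (k + l)%N.
by rewrite natrD (le_trans (ler_normD _ _)) // lerD.
Qed.

Lemma finite_eltM (x y : K) : finite_elt x -> finite_elt y -> finite_elt (x * y).
Proof.
move=> [k xk] [l yl]; exists (k * l)%N.
by rewrite natrM normrM ler_pM.
Qed.

Lemma finite_eltN (x : K) : finite_elt x -> finite_elt (- x).
Proof. by move=> [k xk]; exists k; rewrite normrN. Qed.

(** A pointwise bound on the speed, unlike one on the length, yields pointwise bounds for functions
    along the curve and so passes through the induction. The end points are left out because the
    values of [g] outside [0, 1] are arbitrary. *)
Definition speed_le_curve m (X : set 'rV[K]_m) (g : K -> 'rV[K]_m) (B : K) : Prop :=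
  [/\ definable_curve S g, forall t, unit_itv t -> X (g t) &
      forall t : K, 0 < t < 1 -> exists2 v, is_derive t 1 g v & enorm v <= B].

Lemma speed_le_curveW m (X : set 'rV[K]_m) g B C :
  B <= C -> speed_le_curve X g B -> speed_le_curve X g C.
Proof.
move=> BC [dg Xg g']; split=> // t /g'[v gv vB].
by exists v => //; exact: le_trans BC.
Qed.

Lemma near_in_unit_itv m (X : set 'rV[K]_m) (g : K -> 'rV[K]_m) (t : K) :
  (forall t, unit_itv t -> X (g t)) -> 0 < t < 1 -> \forall h \near 0, X (g (t + h)).
Proof.
move=> Xg /andP[t0 t1]; apply/nbhs_normP; exists (Num.min t (1 - t)) => /=.
  by rewrite lt_min t0 subr_gt0.
move=> h /=; rewrite sub0r normrN lt_min !ltr_norml => /andP[/andP[? ?] /andP[? ?]].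
by apply: Xg; rewrite /unit_itv /=; apply/andP; split; lra.
Qed.

(** The chain rule gives the derivative; the velocity is tangent to [X], where the differential of
    [f] has norm at most [M]. *)
Lemma Mfun_along (M B : K) m (X : set 'rV[K]_m) (f : 'rV[K]_m -> K) g :
  0 <= M -> C1_Mfun S M X f -> speed_le_curve X g B ->
  [/\ curve_definable S (f \o g), {within @unit_itv K, continuous (f \o g)} &
      forall t : K, 0 < t < 1 ->
        exists2 d, is_derive t 1 (f \o g) d & `|d| <= M * B].
Proof.
move=> M0 [deff [A [_ fA AM]]] [defg Xg g']; split.
- exact: curve_definable_comp deff defg Xg.
- have [/within_continuousP cg _] := defg; apply/within_continuousP => t t01 e e0.
  have /within_continuousP cf := within_continuous_differential fA.
  have [d d0 dP] := cf _ (Xg _ t01) e e0; have [d' d'0 d'P] := cg _ t01 d d0.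
  by exists d' => // s s01 /(d'P _ s01); apply: dP; exact: Xg.
- move=> t t01; have [v gv vB] := g' t t01.
  have Xt := near_in_unit_itv Xg t01.
  have Xgt : X (g t) by apply: Xg; case/andP: t01 => ? ?; rewrite /unit_itv /= !ltW.
  exists ((v *m A (g t)) 0 0); first exact: is_derive_along Xt gv (fA _ Xgt).
  apply: le_trans (AM _ Xgt _ (tangent_velocity Xt gv)) _.
  by rewrite ler_wpM2l.
Qed.

Lemma Mfun_along_le (M B : K) m (X : set 'rV[K]_m) (f : 'rV[K]_m -> K) g t :
  o_minimal S -> 0 <= M -> 0 <= B -> C1_Mfun S M X f -> speed_le_curve X g B ->
  unit_itv t -> `|f (g t) - f (g 0)| <= M * B.
Proof.
move=> omin M0 B0 fM gB t01; have [dfg cfg fg'] := Mfun_along M0 fM gB.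
apply: le_trans (mean_value omin dfg cfg fg' t01) _.
by rewrite ler_piMr ?mulr_ge0 //; case/andP: t01.
Qed.

(** The common lifting step for graphs and bands: the speed of the lift is at most the sum of the
    horizontal and the vertical speed. *)
Lemma speed_le_curve_snoc m (X : set 'rV[K]_m) (Y : set 'rV[K]_m.+1) g phi B C :
  speed_le_curve X g B -> curve_definable S phi ->
  {within @unit_itv K, continuous phi} ->
  (forall t : K, 0 < t < 1 -> exists2 d, is_derive t 1 phi d & `|d| <= C) ->
  (forall t, unit_itv t -> Y (snoc_row (g t) (phi t))) ->
  speed_le_curve Y (fun t => snoc_row (g t) (phi t)) (B + C).
Proof.
move=> [defg _ g'] defphi cphi phi' Yg; split=> //.
  exact: definable_curve_snoc_row.
move=> t t01; have [v gv vB] := g' t t01; have [d phid dC] := phi' t t01.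
exists (snoc_row v d); first exact: is_derive_snoc_row.
apply: le_trans (enorm_le_last _) _.
by rewrite col'_snoc_row snoc_row_last lerD.
Qed.

Definition joined_by_curves m (X : set 'rV[K]_m) (c : K) : Prop :=
  forall x y, X x -> X y -> exists g,
    [/\ speed_le_curve X g (c * enorm (x - y)), g 0 = x & g 1 = y].

Lemma itv_affine (a b x y t : K) : a < x < b -> a < y < b -> unit_itv t ->
  a < x + (y - x) * t < b.
Proof.
move=> /andP[ax xb] /andP[ay yb] /andP[]; rewrite le_eqVlt.
move=> /predU1P[<- _|t0 t1]; first by rewrite mulr0 addr0 ax.
by apply/andP; split; nra.
Qed.

(** Points and intervals of the line are convex, so a segment run through at constant speed stays
    inside. *)
Lemma joined_segment (X : set 'rV[K]_1) :
  (forall x y t, X x -> X y -> unit_itv t ->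
     X (x 0 0 + (y 0 0 - x 0 0) * t)%:M) -> joined_by_curves X 1.
Proof.
move=> Xxy x y Xx Xy; exists (fun t => (x 0 0 + (y 0 0 - x 0 0) * t)%:M).
split.
- split=> [|t t01|t t01]; [exact: definable_segment|exact: Xxy|].
  exists (y 0 0 - x 0 0)%:M; first exact: is_derive_segment.
  apply: le_trans (enorm_le_sum _) _; rewrite big_ord1 mxE eqxx mulr1n mul1r.
  rewrite distrC; have := last_le_enorm (x - y).
  by rewrite !mxE (_ : ord_max = 0) //; apply: val_inj.
- by apply/rowP => i; rewrite !mxE ord1 eqxx mulr1n mulr0 addr0.
- by apply/rowP => i; rewrite !mxE ord1 eqxx mulr1n mulr1 addrC subrK.
Qed.

Lemma joined_graph (M c : K) m (X : set 'rV[K]_m) f :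
  0 <= M -> 0 <= c -> C1_Mfun S M X f ->
  joined_by_curves X c -> joined_by_curves (graph_over X f) ((1 + M) * c).
Proof.
move=> M0 c0 fM Xc x y [Xx xf] [Xy yf].
have [g [gB g0 g1]] := Xc _ _ Xx Xy.
have [defphi cphi phi'] := Mfun_along M0 fM gB.
exists (fun t => snoc_row (g t) ((f \o g) t)); split.
- have [_ Xg _] := gB.
  apply: speed_le_curveW (speed_le_curve_snoc gB defphi cphi phi' _) => [|t t01].
    (* The base curve has speed at most [c] times the distance of the projections, the height at
       most [M] times as much; projecting does not increase distances. *)
    rewrite -{1}[c * _]mul1r -mulrDl -mulrA ler_wpM2l ?addr_ge0 // ler_wpM2l //.
    exact: enorm_col'B_le.
  by rewrite /graph_over /= col'_snoc_row snoc_row_last; split=> //; exact: Xg.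
- by apply: row_lastP; rewrite ?col'_snoc_row // snoc_row_last /= g0.
- by apply: row_lastP; rewrite ?col'_snoc_row // snoc_row_last /= g1.
Qed.

Lemma is_derive_affine (a b t : K) : is_derive t 1 (fun t => a + b * t) b.
Proof.
apply/is_derive_littleo => e e0; exists 1 => // h _.
rewrite [X in `|X|](_ : _ = 0); first by rewrite normr0 mulr_ge0 // ltW.
by rewrite /GRing.scale /=; ring.
Qed.

(* The height is moved affinely from one end to the other, relatively to the
   interval between the two bounding functions. *)
Lemma joined_band (M c : K) m (X : set 'rV[K]_m) f h :
  o_minimal S -> 0 <= M -> 0 <= c -> C1_Mfun S M X f -> C1_Mfun S M X h ->
  (forall x, X x -> f x < h x) ->
  joined_by_curves X c -> joined_by_curves (band_over X f h) (1 + (1 + 8%:R * M) * c).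
Proof.
move=> omin M0 c0 fM hM fh Xc x y [Xx /andP[fx xh]] [Xy /andP[fy yh]].
have [g [gB' g0 g1]] := Xc _ _ Xx Xy.
pose D := enorm (x - y); pose B := c * D.
have gB : speed_le_curve X g B.
  by apply: speed_le_curveW gB'; rewrite ler_wpM2l // enorm_col'B_le.
have B0 : 0 <= B by rewrite mulr_ge0 // enorm_ge0.
have [deff cf f'] := Mfun_along M0 fM gB.
have [defh ch h'] := Mfun_along M0 hM gB.
pose w t := h (g t) - f (g t).
have [_ Xg _] := gB.
have w0 t : unit_itv t -> 0 < w t by move=> /Xg/fh; rewrite subr_gt0.
have u0 : unit_itv (0 : K) by rewrite /unit_itv /= lexx ler01.
have u1 : unit_itv (1 : K) by rewrite /unit_itv /= lexx ler01.
have w00 := w0 _ u0; have w01 := w0 _ u1.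
(* The relative heights of the two end points between the bounding functions. The width [w] may be
   infinitesimal, so [b - a] alone has no useful bound; only its products with [w] do. *)
pose a := (x 0 ord_max - f (g 0)) / w 0.
pose b := (y 0 ord_max - f (g 1)) / w 1.
have a01 : 0 < a < 1.
  apply/andP; split; first by rewrite divr_gt0 // subr_gt0 g0.
  by rewrite ltr_pdivrMr // mul1r /w ltrD2r g0.
have b01 : 0 < b < 1.
  apply/andP; split; first by rewrite divr_gt0 // subr_gt0 g1.
  by rewrite ltr_pdivrMr // mul1r /w ltrD2r g1.
have aE : a * w 0 = x 0 ord_max - f (g 0) by rewrite /a divfK // gt_eqF.
have bE : b * w 1 = y 0 ord_max - f (g 1) by rewrite /b divfK // gt_eqF.
pose u t := a + (b - a) * t.
have u01 t : unit_itv t -> 0 < u t < 1 by exact: itv_affine.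
pose phi t := f (g t) + u t * w t.
have wB t : unit_itv t -> `|w t - w 0| <= 2%:R * (M * B).
  move=> t01; have := Mfun_along_le omin M0 B0 fM gB t01.
  have := Mfun_along_le omin M0 B0 hM gB t01.
  by rewrite /w !ler_norml => /andP[? ?] /andP[? ?]; apply/andP; split; lra.
(* The four terms of the identity contribute [D], [M * B], [2 * (M * B)] and [2 * (M * B)]; the last
   two use that [b] and [b - a] are at most 1 in absolute value. *)
have baB t : unit_itv t -> `|b - a| * w t <= D + 5%:R * (M * B).
  move=> t01; have E : (b - a) * w t = (y 0 ord_max - x 0 ord_max) -
      (f (g 1) - f (g 0)) - b * (w 1 - w 0) + (b - a) * (w t - w 0).
    have -> : y 0 ord_max - x 0 ord_max = b * w 1 + f (g 1) - (a * w 0 + f (g 0)).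
      by rewrite aE bE !subrK.
    by ring.
  rewrite -[w t](ger0_norm (ltW (w0 _ t01))) -normrM E.
  have h1 : `|y 0 ord_max - x 0 ord_max| <= D.
    by rewrite distrC; have := last_le_enorm (x - y); rewrite !mxE.
  have h2 := Mfun_along_le omin M0 B0 fM gB u1.
  have h3 : `|b * (w 1 - w 0)| <= 2%:R * (M * B).
    rewrite normrM -[leRHS]mul1r ler_pM ?wB //.
    by case/andP: b01 => ? ?; rewrite ger0_norm ltW.
  have h4 : `|(b - a) * (w t - w 0)| <= 2%:R * (M * B).
    rewrite normrM -[leRHS]mul1r ler_pM ?wB //.
    case/andP: a01 b01 => ? ? /andP[? ?].
    by rewrite ler_norml; apply/andP; split; lra.
  by move: h1 h2 h3 h4; rewrite !ler_norml => /andP[? ?] /andP[? ?] /andP[? ?] /andP[? ?];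
    apply/andP; split; lra.
have defphi : curve_definable S phi by exact: curve_definable_convex deff defh.
have cphi : {within @unit_itv K, continuous phi}.
  have cu : continuous u.
    move=> t; apply: differentiable_continuous; apply/derivable1_diffP.
    by have [] := is_derive_affine a (b - a) t.
  move=> t; apply: cvgD; first exact: cf.
  apply: cvgM; first by apply: continuous_subspaceT.
  by apply: cvgB; [exact: ch|exact: cf].
have phi' (t : K) : 0 < t < 1 -> exists2 d, is_derive t 1 phi d & `|d| <= D + 8%:R * (M * B).
  move=> t01; have [df dfg dfB] := f' t t01; have [dh dhg dhB] := h' t t01.
  have t01' : unit_itv t by case/andP: t01 => ? ?; rewrite /unit_itv /= !ltW.
  (* The product rule. The three summands are bounded by [M * B], [2 * (M * B)] and
     [D + 5 * (M * B)], which makes 8 in all. *)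
  exists (df + (u t * (dh - df) + w t * (b - a))).
    have := is_deriveD dfg (is_deriveM (is_derive_affine a (b - a) t) (is_deriveB dhg dfg)).
    by [].
  have h1 := baB t t01'; have /ltW wt0 := w0 t t01'; have /andP[u0' u1'] := u01 t t01'.
  have h2 : `|u t * (dh - df)| <= 2%:R * (M * B).
    rewrite normrM -[leRHS]mul1r ler_pM //; first by rewrite ger0_norm ltW.
    by move: dfB dhB; rewrite !ler_norml => /andP[? ?] /andP[? ?]; apply/andP; split; lra.
  have h3 : `|w t * (b - a)| <= D + 5%:R * (M * B).
    by rewrite mulrC normrM (ger0_norm wt0).
  by move: dfB h2 h3; rewrite !ler_norml => /andP[? ?] /andP[? ?] /andP[? ?];
    apply/andP; split; lra.
exists (fun t => snoc_row (g t) (phi t)); split.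
- apply: speed_le_curveW (speed_le_curve_snoc gB defphi cphi phi' _) => [|t t01].
    (* With [B = c * D], the sum [B + (D + 8 * (M * B))] is exactly the claimed constant times
       [D]. *)
    by rewrite -/D /B le_eqVlt; apply/orP; left; apply/eqP; ring.
  rewrite /band_over /= col'_snoc_row snoc_row_last; split; first exact: Xg.
  have wt0 := w0 t t01; have /andP[? ?] := u01 t t01.
  rewrite /phi ltrDl mulr_gt0 //= -ltrBrDl.
  by rewrite -[ltRHS]mul1r ltr_pM2r.
- apply: row_lastP; rewrite ?col'_snoc_row // snoc_row_last /phi /u mulr0 addr0.
  by rewrite aE addrC subrK.
- apply: row_lastP; rewrite ?col'_snoc_row // snoc_row_last /phi /u mulr1.
  by rewrite (addrC a) subrK bE addrC subrK.
Qed.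

(** The constant is built from [M] and natural numbers by finitely many sums and products, hence is
    finite with [M]. *)
Lemma Mcell_joined (M : K) n (X : set 'rV[K]_n) :
  o_minimal S -> 0 < M -> finite_elt M -> Mcell S M X ->
  exists c, [/\ finite_elt c, 0 < c & joined_by_curves X c].
Proof.
move=> omin M0 Mfin; have M0' := ltW M0.
elim=> {n X} [a|a b ab|m X f _ [c [cfin c0 Xc]] fM|m X f h _ [c [cfin c0 Xc]] fM hM fh].
- exists 1; split=> //; first exact: (finite_elt_nat 1).
  apply: joined_segment => x y t /= -> -> _.
  by rewrite mxE eqxx mulr1n subrr mul0r addr0.
- exists 1; split=> //; first exact: (finite_elt_nat 1).
  apply: joined_segment => x y t /= xab yab t01.
  by rewrite mxE eqxx mulr1n itv_affine.
- exists ((1 + M) * c); split; last exact: joined_graph (ltW c0) fM Xc.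
    exact: finite_eltM (finite_eltD (finite_elt_nat 1) Mfin) cfin.
  by rewrite mulr_gt0 ?addr_gt0.
- exists (1 + (1 + 8%:R * M) * c); split.
  + apply: finite_eltD (finite_elt_nat 1) (finite_eltM (finite_eltD (finite_elt_nat 1) _) cfin).
    exact: finite_eltM (finite_elt_nat 8) Mfin.
  + by rewrite addr_gt0 // mulr_gt0 // addr_gt0 // mulr_gt0.
  + exact: joined_band (ltW c0) fM hM fh Xc.
Qed.

End CellCurves.

(** * An upper bound for integrals of possibly non-measurable functions *)

Section IntegralBound.
Import HBNNSimple.
Local Open Scope ereal_scope.

(* The domain D and the integrand f need not be measurable: only simple
   functions below f, whose supports are measurable subsets of D, matter. *)
Lemma integral_le_of_subsets d (T : measurableType d) (R : realType)
    (mu : {measure set T -> \bar R}) (D N : set T) (f : T -> R) (b : R)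
    (m : \bar R) :
  (0 <= b)%R -> measurable N -> mu N = 0 ->
  (forall Z, measurable Z -> Z `<=` D -> mu Z <= m) ->
  (forall x, D x -> 0 <= f x)%R ->
  (forall x, D x -> ~ N x -> f x <= b)%R ->
  \int[mu]_(x in D) (f x)%:E <= b%:E * m.
Proof.
move=> b0 mN N0 muD f0 fb; rewrite ge0_integralE => [|x Dx]; last first.
  by rewrite lee_fin f0.
apply: ge_ereal_sup => _ [h /= hf <-].
(* The support of the simple function. It lies in [D] because the integrand is extended by 0 outside
   [D] and [h] is nonnegative. *)
pose Z := h @^-1` [set~ 0%R].
have mZ : measurable Z by rewrite -[Z]setTI; apply: (@measurable_funPT _ _ _ _ h) => //; exact: measurableC.
have ZD : Z `<=` D.
  move=> x /eqP hx; apply: contrapT => Dx; have := hf x.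
  rewrite /patch memNset // lee_fin => h0.
  by move: hx; rewrite eq_le h0 fun_ge0.
have -> : sintegral mu h = sintegral mu (h \_ Z).
  apply: eq_sintegral => x; rewrite /patch; case: ifPn => //.
  by rewrite notin_setE => /contrapT.
rewrite -integral_nnsfun //.
(* On [Z] the function [h] is at most [b] except on the null set [N], and the constant [b]
   integrates to [b] times the measure of [Z]. *)
apply: le_trans (_ : \int[mu]_(x in Z) cst b%:E x <= _); last first.
  by rewrite integral_cst // lee_wpmul2l ?lee_fin // muD.
apply: ae_ge0_le_integral => //.
- by move=> x _; rewrite lee_fin fun_ge0.
- by apply/measurable_EFinP; apply: measurable_funS (@measurable_funPT _ _ _ _ h).
exists N; split=> // x /= /not_implyP[Zx hb]; apply: contrapT => Nx; apply: hb.
apply: le_trans (hf x) _; rewrite /patch mem_set ?lee_fin; last exact: ZD.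
by apply: fb => //; exact: ZD.
Qed.

End IntegralBound.

(** * Order properties of the standard part *)

Section StandardPart.
Context (R : realType) (K : rcfType).

Lemma st_nonempty (x : K) : 0 <= x ->
  [set @ratr R q | q in [set q : rat | ratr q < x]] !=set0.
Proof.
move=> x0; exists (ratr (-1)), (-1) => //=.
by rewrite rmorphN1 (lt_le_trans _ x0) // ltrN10.
Qed.

Lemma st_ge0 (x : K) : 0 <= x -> 0 <= st R x.
Proof.
move=> x0; rewrite /st; set A := (X in sup X).
(* If [x] is infinite, the set of rationals below it has no supremum and [sup] takes its default
   value 0. *)
have [supA|/sup_out ->//] := pselect (has_sup A).
rewrite leNgt; apply/negP => /rat_in_itvoo[q]; rewrite in_itv /= => /andP[+ q0].
rewrite ltNge => /negP; apply; apply: ub_le_sup; first by case: supA.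
exists q => //=; apply: lt_le_trans x0.
by rewrite ltrq0; rewrite ltrq0 in q0.
Qed.

Lemma st_le (x y : K) : 0 <= x -> x <= y -> finite_elt y -> st R x <= st R y.
Proof.
move=> x0 xy [k yk]; apply: sup_le.
- move=> _ [q /= qx <-]; exists (ratr q); split=> //.
  by exists q => //=; exact: lt_le_trans xy.
- exact: st_nonempty.
- split; first by apply: st_nonempty; exact: le_trans xy.
  exists k%:R => _ [q /= qy <-].
  (* A bound in [K] is carried over to the reals through the rationals, which embed in both
     fields. *)
  have : ratr q <= ratr k%:R :> K.
    by rewrite ratr_nat (le_trans (ltW qy)) // (le_trans (ler_norm _)).
  by rewrite ler_rat -(ler_rat R) ratr_nat.
Qed.

Lemma st_le1 (x : K) : 0 <= x <= 1 -> st R x <= 1.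
Proof.
move=> /andP[x0 x1]; apply: ge_sup; first exact: st_nonempty.
move=> _ [q /= qx <-]; have : ratr q <= ratr 1 :> K.
  by rewrite rmorph1 (le_trans (ltW qx)).
by rewrite ler_rat -(ler_rat R) rmorph1.
Qed.

End StandardPart.

(** * Outer measure of the unit interval and the bound on lengths *)

Section OuterMeasure.
Context (R : realType) (L : signature) (K : rcfType) (S : expansion L K).
Local Open Scope ereal_scope.

Lemma BO_outer_le (A : set K) : definable1 S A -> finite_diameter A ->
  BO_outer S R A <= BO_premeasure R (A : set (BO_type S)).
Proof.
move=> defA finA; apply: ereal_inf_lbound.
(* The cover by [A] itself followed by empty sets. *)
exists (fun n => if n is 0%N then A else set0).
  split=> [[|n]|t At]; [exact: (conj defA finA)|exact: BO_sets0|by exists 0%N].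
apply/cvg_lim => //; rewrite -cvg_shiftS.
rewrite (_ : [sequence _]_n = cst (BO_premeasure R (A : set (BO_type S)))).
  exact: cvg_cst.
rewrite funeqE => n /=; rewrite big_nat_recl //= big1 ?adde0 // => i _.
exact: BO_premeasure0.
Qed.

Lemma definable1_env (A : set K) (P : (nat -> K) -> Prop) : env_definable S P ->
  (forall e, A (e 0%N) <-> P e) -> definable1 S A.
Proof.
move=> dP AP; apply: definable_env dP _ => x /=.
by rewrite -AP -[0%N]/(@ord0 0 : nat) point_envE.
Qed.

(** A point is definable and its image under the translated standard part is a single real, which is
    Lebesgue null. *)
Lemma BO_outer_point (a : K) : BO_outer S R [set a] = 0.
Proof.
apply/eqP; rewrite eq_le outer_measure_ge0 andbT.
have -> : 0 = BO_premeasure R ([set a] : set (BO_type S)).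
  by rewrite /BO_premeasure image_set1 lebesgue_measure_set1.
apply: BO_outer_le.
  by apply: definable1_env (env_definable_eq S (TVar L K 0%N) (TPar L a)) _.
by exists 0%N => x y -> ->; rewrite subrr normr0.
Qed.

Lemma BO_outer_unit_itv : BO_outer S R (@unit_itv K) <= 1.
Proof.
apply: le_trans (BO_outer_le _ _) _.
- apply: definable1_env (env_definable_and
    (env_definable_le S (TPar L 0%R) (TVar L K 0%N))
    (env_definable_le S (TVar L K 0%N) (TPar L 1%R))) _ => e.
  by split=> /andP.
- exists 1%N => x y /andP[? ?] /andP[? ?].
  by rewrite ler_norml; apply/andP; split; lra.
have -> : 1 = lebesgue_measure ([set` `[0%R, 1%R]] : set R).
  by rewrite lebesgue_measure_itv /= lte_fin ltr01 oppr0 adde0.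
(* The unit interval of [K] consists of finite elements, so its base point is 0 and there is no
   translation. *)
have -> : BO_premeasure R (@unit_itv K : set (BO_type S)) =
    lebesgue_measure [set st R x | x in @unit_itv K].
  rewrite /BO_premeasure /BO_base asboolT.
    by congr lebesgue_measure; apply: eq_imagel => x _; rewrite subr0.
  by move=> x /andP[? ?]; exists 1%N; rewrite ger0_norm.
(* Lebesgue measure is used as an outer measure: the inclusion of the image in the real unit
   interval suffices, without its measurability. *)
apply: le_mu_ext => _ [x /= x01 <-]; rewrite in_itv /= st_le1 // andbT.
by apply: st_ge0; case/andP: x01.
Qed.

(** The integrand is at most [st R B] outside the two end points, and the measurable subsets of
    [0, 1] have measure at most 1. *)
Lemma curve_length_le n (X : set 'rV[K]_n) (g : K -> 'rV[K]_n) (B : K) :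
  (0 <= B)%R -> finite_elt B -> speed_le_curve S X g B ->
  curve_length R S g <= (st R B)%:E.
Proof.
move=> B0 Bfin [_ _ g']; pose N : set K := [set 0%R] `|` [set 1%R].
have N0 : BO_outer S R N = 0.
  apply/eqP; rewrite eq_le outer_measure_ge0 andbT.
  apply: le_trans (outer_measureU2 _ _ _) _.
  by rewrite [X in X + _]BO_outer_point [X in _ + X]BO_outer_point adde0.
have mN : measurable (N : set (caratheodory_type (BO_outer S R))).
  (* A set of outer measure 0 is measurable in the sense of Caratheodory. *)
  apply: le_caratheodory_measurable => Y.
  rewrite -[leRHS]add0e leeD //; first by rewrite -N0 le_outer_measure.
  by apply: le_outer_measure; exact: subIsetl.
rewrite -[leRHS]mule1.
apply: (@integral_le_of_subsets _ (caratheodory_type (BO_outer S R)) R (L1 S R)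
  (@unit_itv K) N (fun t => st R (enorm (derive1 g t)))) => //.
- exact: st_ge0.
- by move=> Z _ /(le_outer_measure (BO_outer S R))/le_trans; apply; exact: BO_outer_unit_itv.
- by move=> t _; apply: st_ge0; exact: enorm_ge0.
move=> t /andP[t0 t1] Nt.
have t01 : (0 < t < 1)%R.
  by rewrite !lt_neqAle t0 t1 !andbT; apply/andP; split; apply/eqP => E;
    apply: Nt; [left|right].
have [v gv vB] := g' t t01; apply: st_le => //; first exact: enorm_ge0.
by rewrite derive1E (derive_val (is_derive := gv)).
Qed.

End OuterMeasure.

(** * From speed bounds to the Whitney arc property *)

Lemma finite_elt_enormB (K : rcfType) n (x y : 'rV[K]_n) :
  (forall i, finite_elt (x 0 i)) -> (forall i, finite_elt (y 0 i)) ->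
  finite_elt (enorm (x - y)).
Proof.
move=> xfin yfin; have [k kE] : finite_elt (\sum_i `|(x - y) 0 i|).
  elim/big_ind: _ => [|a b|i _]; [exact: (finite_elt_nat K 0)|exact: finite_eltD|].
  have [k kE] : finite_elt ((x - y) 0 i).
    by rewrite !mxE; apply: finite_eltD => //; exact: finite_eltN.
  by exists k; rewrite normr_id.
exists k; rewrite ger0_norm ?enorm_ge0 //.
by rewrite (le_trans (enorm_le_sum _)) // (le_trans (ler_norm _)).
Qed.

Theorem lemma4p7 (R : realType) (K : rcfType) (L : signature)
    (S : expansion L K) (Somin : o_minimal S) (Ssat : aleph1_saturated S)
    (M : K) (M_gt0 : 0 < M) (M_fin : finite_elt M)
    (n : nat) (C : set 'rV[K]_n) (C_cell : Mcell S M C)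
    (C_fin : forall x, C x -> forall i, finite_elt (x 0 i)) :
  whitney_arc_property R S C.
Proof.
have [c [cfin c0 Cc]] := Mcell_joined Somin M_gt0 M_fin C_cell.
exists c; split=> // x y Cx Cy.
have [g [gB g0 g1]] := Cc x y Cx Cy.
have B0 : 0 <= c * enorm (x - y) by rewrite mulr_ge0 ?enorm_ge0 // ltW.
(* The finiteness of the points of [C] makes the speed bound finite, so that standard parts below it
   can be compared. *)
have Bfin : finite_elt (c * enorm (x - y)).
  by apply: finite_eltM => //; apply: finite_elt_enormB; exact: C_fin.
have [defg Cg g'] := gB.
exists g; split=> //; last exact: curve_length_le gB.
(* The derivative is known in the open interval only, so both end points are exceptional. *)
exists [:: 0; 1] => t /andP[t0 t1]; rewrite !inE negb_or => /andP[tn0 tn1].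
have [|v gv vB] := g' t; first by rewrite !lt_neqAle eq_sym tn0 tn1 t0.
split; first by case: gv.
have [k Bk] := Bfin; exists k; rewrite derive1E (derive_val (is_derive := gv)).
rewrite ger0_norm ?enorm_ge0 //; apply: le_trans vB _.
by apply: le_trans Bk; exact: ler_norm.
Qed.
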